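(* Let $D_2=\{(a,b): a,b>0,\ 1/a+1/b\le 4\}$ and $D_3=\{(a,b): a,b>0,\ a+b\le 1\}$, and let $a,b>0$ with $(a,b)\neq(1/2,1/2)$. Consider the function $$s(r)=(1+\sqrt{r})\,F(a,b;a+b;r)-F\Bigl(a,b;a+b;\frac{4\sqrt{r}}{(1+\sqrt{r})^2}\Bigr),\qquad r\in(0,1).$$ If $(a,b)\in D_3$, then $s$ is monotone increasing in $r\in(0,1)$. If $(a,b)\in D_2$, then $s$ is monotone decreasing in $r\in(0,1)$.
   Context: For real $a,b,c$ with $c\ne 0,-1,-2,\dots$, the Gaussian hypergeometric function is $F(a,b;c;x)=\sum_{n=0}^\infty \frac{(a,n)(b,n)}{(c,n)}\frac{x^n}{n!}$ for $x\in(-1,1)$, where $(a,n)=a(a+1)\cdots(a+n-1)$ for $n\ge 1$ and $(a,0)=1$. Here $a,b$ are real numbers. *)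

(* Defs.v *)
From Stdlib Require Import Reals Factorial.
From Coquelicot Require Import Coquelicot.
Open Scope R_scope.

Fixpoint poch (a : R) (n : nat) : R :=
  match n with
  | O => 1
  | S m => poch a m * (a + INR m)
  end.

(* [PSeries] is total: the value is the sum of the series only where it
   converges, in particular for |x| < 1 when c is not 0, -1, -2, ... *)
Definition hypergeom (a b c x : R) : R :=
  PSeries (fun n => poch a n * poch b n / poch c n / INR (fact n)) x.

Definition D2 (a b : R) : Prop := 0 < a /\ 0 < b /\ 1 / a + 1 / b <= 4.

Definition D3 (a b : R) : Prop := 0 < a /\ 0 < b /\ a + b <= 1.

Definition s (a b r : R) : R :=
  (1 + sqrt r) * hypergeom a b (a + b) r
  - hypergeom a b (a + b) (4 * sqrt r / (1 + sqrt r) ^ 2).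

(* Strict monotonicity: s a b is identically 0 at the excluded pair
   (a, b) = (1/2, 1/2), by Landen's identity. *)
Definition increasing_on_01 (f : R -> R) : Prop :=
  forall r1 r2 : R, 0 < r1 -> r1 < r2 -> r2 < 1 -> f r1 < f r2.

Definition decreasing_on_01 (f : R -> R) : Prop :=
  forall r1 r2 : R, 0 < r1 -> r1 < r2 -> r2 < 1 -> f r2 < f r1.

(* Main.v *)
Require Import Defs.
From Stdlib Require Import Reals Factorial Lra Lia.
From Coquelicot Require Import Coquelicot.
Open Scope R_scope.

(** Put x = sqrt r and y = 4 x / (1 + x)^2, and for a function F on [0, 1)
    consider its Landen gap S_F(x) = (1 + x) F(x^2) - F(y), which is s a b r
    when F is the hypergeometric function of the statement.  Let G be
    F(1/2, 1/2; 1; .), a multiple of the complete elliptic integral of the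
    first kind as a function of the squared modulus.  Landen's identity says
    that S_G = 0.  The theorem follows by comparing F with G.

    Let c_n be the quotient of the n-th Taylor coefficients of F and G.  On D3
    it decreases and on D2 it increases, strictly for n >= 1 in both cases
    ([half_coef_cross]).  Suppose that it decreases, put z = x^2, which is
    less than y, and rho = F'(z) / G'(z).  A quotient of power series inherits
    the monotonicity of the quotient of their coefficients, so
    F'(y) < rho G'(y) ([PSeries_derive_ratio_decr]), and F / G decreases, so
    that F(z) >= rho G(z) ([PSeries_wronskian_nonneg]).  Hence
      S_F'(x) = F(z) + 2 x (1 + x) F'(z) - F'(y) y'(x)
              > rho (G(z) + 2 x (1 + x) G'(z) - G'(y) y'(x))
              = rho S_G'(x) = 0.
    If c_n increases, exchange F and G ([landen_gap_derive_cmp]).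

    Landen's identity itself comes from the differential equation of G
    ([landen_of_ode]): both (1 + x) G(x^2) and G(y) solve the same
    self-adjoint second-order equation, whose leading coefficient vanishes
    at 0, so their Wronskian vanishes and they are proportional. *)

(** * Quotients of power series *)

Lemma unit_disk (p : nat -> R) (x : R) :
  CV_radius p = 1 -> 0 <= x < 1 -> Rbar_lt (Rabs x) (CV_radius p).
Proof. intros -> Hx; simpl; apply Rabs_def1; lra. Qed.

Lemma is_lim_seq_partial_sums (p : nat -> R) (x : R) :
  CV_radius p = 1 -> 0 <= x < 1 ->
  is_lim_seq (sum_f_R0 (fun n => p n * x ^ n)) (PSeries p x).
Proof.
  intros Hp Hx.
  apply is_lim_seq_ext with (sum_n (fun n => p n * x ^ n)).
  { intros n; apply sum_n_Reals. }
  apply Series_correct, ex_pseries_R, CV_radius_inside.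
  now apply unit_disk.
Qed.

Lemma PSeries_pos (p : nat -> R) (x : R) :
  CV_radius p = 1 -> (forall n, 0 < p n) -> 0 <= x < 1 -> 0 < PSeries p x.
Proof.
  intros Hp Hpos Hx.
  pose proof (is_lim_seq_incr_compare _ _ (is_lim_seq_partial_sums p x Hp Hx))
    as H.
  apply Rlt_le_trans with (sum_f_R0 (fun n => p n * x ^ n) 0).
  - simpl; rewrite Rmult_1_r; apply Hpos.
  - apply H; intros n; rewrite tech5.
    pose proof (pow_le x (S n) (proj1 Hx)).
    specialize (Hpos (S n)); nra.
Qed.

(** The hypothesis compares neighbours without dividing by the coefficients;
    chaining it needs q positive so that the intermediate factor cancels. *)
Lemma ratio_nonincr (p q : nat -> R) :
  (forall n, 0 < q n) ->
  (forall n, p (S n) * q n <= p n * q (S n)) ->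
  forall n k, p (n + k)%nat * q n <= p n * q (n + k)%nat.
Proof.
  intros Hq Hpq n k; induction k as [|k IH].
  - rewrite Nat.add_0_r; lra.
  - rewrite Nat.add_succ_r.
    pose proof (Hq n); pose proof (Hq (n + k)%nat); pose proof (Hpq (n + k)%nat).
    pose proof (Hq (S (n + k))).
    apply Rmult_le_reg_r with (q (n + k)%nat); [assumption|].
    apply Rle_trans with (p (n + k)%nat * q (S (n + k)) * q n); nra.
Qed.

Lemma pow_cross_le (z t : R) (n m : nat) :
  0 <= z -> z <= t -> (n <= m)%nat -> z ^ m * t ^ n <= z ^ n * t ^ m.
Proof.
  intros Hz Ht Hnm.
  replace m with (n + (m - n))%nat by lia.
  rewrite !pow_add.
  pose proof (pow_incr z t (m - n) (conj Hz Ht)).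
  pose proof (pow_le z n Hz).
  assert (0 <= t ^ n) by (apply pow_le; lra).
  assert (0 <= z ^ n * t ^ n) by nra.
  nra.
Qed.

(** This is the increment, from index N to index m = N + 1, of the cross
    difference P_N(z) Q_N(t) - P_N(t) Q_N(z) of partial sums, up to two
    cancelling terms.  It is a sum over n of the products
    (p_n q_m - p_m q_n) (z^n t^m - z^m t^n), whose two factors are
    nonnegative.  Keeping m fixed lets the induction run on N alone. *)
Lemma sum_cross_nonneg (p q : nat -> R) (z t : R) (m N : nat) :
  (forall n, 0 < q n) ->
  (forall n, p (S n) * q n <= p n * q (S n)) ->
  0 <= z -> z <= t -> (N <= m)%nat ->
  0 <= p m * z ^ m * sum_f_R0 (fun n => q n * t ^ n) N
       + q m * t ^ m * sum_f_R0 (fun n => p n * z ^ n) N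
       - p m * t ^ m * sum_f_R0 (fun n => q n * z ^ n) N
       - q m * z ^ m * sum_f_R0 (fun n => p n * t ^ n) N.
Proof.
  intros Hq Hpq Hz Ht.
  assert (Hterm : forall n, (n <= m)%nat ->
    0 <= (p n * q m - p m * q n) * (z ^ n * t ^ m - z ^ m * t ^ n)).
  { intros n Hn.
    pose proof (ratio_nonincr p q Hq Hpq n (m - n)) as H.
    replace (n + (m - n))%nat with m in H by lia.
    pose proof (pow_cross_le z t n m Hz Ht Hn); nra. }
  induction N as [|N IH]; intros HN.
  - simpl sum_f_R0; specialize (Hterm 0%nat HN); simpl in Hterm; lra.
  - rewrite !tech5.
    specialize (IH ltac:(lia)); specialize (Hterm (S N) HN); lra.
Qed.

(** The cross differences of the partial sums increase with the number of
    terms, so their limit is at least the one with two terms, which is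
    (p_0 q_1 - p_1 q_0) (t - z) > 0.  This gives strictness in the limit from
    strictness of the coefficients at one index. *)
Lemma PSeries_ratio_decr (p q : nat -> R) (z t : R) :
  CV_radius p = 1 -> CV_radius q = 1 ->
  (forall n, 0 < q n) ->
  (forall n, p (S n) * q n <= p n * q (S n)) ->
  p 1%nat * q 0%nat < p 0%nat * q 1%nat ->
  0 <= z -> z < t -> t < 1 ->
  PSeries p t * PSeries q z < PSeries p z * PSeries q t.
Proof.
  intros Hp Hq Hqpos Hpq Hpq0 Hz Hzt Ht.
  set (part := fun (c : nat -> R) x => sum_f_R0 (fun n => c n * x ^ n)).
  set (D := fun N => part p z N * part q t N - part p t N * part q z N).
  assert (HD : is_lim_seq (fun N => D (S N))
                 (PSeries p z * PSeries q t - PSeries p t * PSeries q z)).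
  { apply -> (is_lim_seq_incr_1 D).
    apply is_lim_seq_minus'; apply is_lim_seq_mult';
      apply is_lim_seq_partial_sums; auto; lra. }
  assert (Hincr : forall N, D N <= D (S N)).
  { intros N; unfold D, part.
    pose proof (sum_cross_nonneg p q z t (S N) N Hqpos Hpq Hz
                  (Rlt_le _ _ Hzt) ltac:(lia)).
    rewrite !tech5; lra. }
  pose proof (is_lim_seq_incr_compare _ _ HD (fun N => Hincr (S N)) 0%nat) as H.
  assert (0 < D 1%nat); [|lra].
  unfold D, part; simpl; nra.
Qed.

Lemma PS_derive_pos (q : nat -> R) :
  (forall n, 0 < q n) -> forall n, 0 < PS_derive q n.
Proof.
  intros Hq n; unfold PS_derive.
  apply Rmult_lt_0_compat; [apply lt_0_INR; lia | apply Hq].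
Qed.

(** Differentiation multiplies the coefficients p_(n+1) and q_(n+1) by the same
    n + 1, so it preserves the monotonicity of their quotient; strictness is
    required one index later, at 1, since the constant terms disappear. *)
Lemma PSeries_derive_ratio_decr (p q : nat -> R) (z t : R) :
  CV_radius p = 1 -> CV_radius q = 1 ->
  (forall n, 0 < q n) ->
  (forall n, p (S n) * q n <= p n * q (S n)) ->
  p 2%nat * q 1%nat < p 1%nat * q 2%nat ->
  0 <= z -> z < t -> t < 1 ->
  PSeries (PS_derive p) t * PSeries (PS_derive q) z
  < PSeries (PS_derive p) z * PSeries (PS_derive q) t.
Proof.
  intros Hp Hq Hqpos Hpq Hpq1 Hz Hzt Ht.
  apply PSeries_ratio_decr; try assumption.
  - now rewrite CV_radius_derive.
  - now rewrite CV_radius_derive.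
  - now apply PS_derive_pos.
  - intros n; unfold PS_derive; specialize (Hpq (S n)).
    assert (0 <= INR (S n) * INR (S (S n)))
      by (apply Rmult_le_pos; apply pos_INR).
    nra.
  - unfold PS_derive; simpl; lra.
Qed.

(** A monotone form of l'Hopital's rule: P/Q decreases because P'/Q' does.
    With a = Q'(z) and b = P'(z), the function a P - b Q has a nonnegative
    derivative on [0, z], and it is nonnegative at 0 because
    b/a <= p_1/q_1 <= p_0/q_0.  Deriving it from the result on P'/Q' means that
    the quotients at indices 0 and 1 may coincide, which happens on the
    boundary curve of D2. *)
Lemma PSeries_wronskian_nonneg (p q : nat -> R) (z : R) :
  CV_radius p = 1 -> CV_radius q = 1 ->
  (forall n, 0 < q n) ->
  (forall n, p (S n) * q n <= p n * q (S n)) ->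
  p 2%nat * q 1%nat < p 1%nat * q 2%nat ->
  0 < z < 1 ->
  PSeries (PS_derive p) z * PSeries q z
  <= PSeries p z * PSeries (PS_derive q) z.
Proof.
  intros Hp Hq Hqpos Hpq Hpq1 Hz.
  assert (Hmono := fun x y =>
    PSeries_derive_ratio_decr p q x y Hp Hq Hqpos Hpq Hpq1).
  assert (Hdqz := PSeries_pos (PS_derive q) z
            ltac:(now rewrite CV_radius_derive) (PS_derive_pos q Hqpos)
            ltac:(lra)).
  set (a := PSeries (PS_derive q) z) in *.
  set (b := PSeries (PS_derive p) z) in *.
  assert (Hder : forall x, 0 <= x <= z ->
    is_derive (fun x => a * PSeries p x - b * PSeries q x) x
      (a * PSeries (PS_derive p) x - b * PSeries (PS_derive q) x)).
  { intros x Hx.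
    apply (is_derive_minus (fun x => a * PSeries p x)); apply is_derive_scal;
      apply is_derive_PSeries, unit_disk; auto; lra. }
  destruct (MVT_gen (fun x => a * PSeries p x - b * PSeries q x) 0 z
     (fun x => a * PSeries (PS_derive p) x - b * PSeries (PS_derive q) x))
    as (c & Hc & Heq).
  - rewrite Rmin_left, Rmax_right by lra; intros x Hx; apply Hder; lra.
  - rewrite Rmin_left, Rmax_right by lra; intros x Hx.
    apply derivable_continuous_pt; eexists.
    apply is_derive_Reals, Hder, Hx.
  - rewrite Rmin_left, Rmax_right in Hc by lra.
    rewrite !PSeries_0 in Heq.
    assert (0 <= a * PSeries (PS_derive p) c - b * PSeries (PS_derive q) c).
    { destruct (Req_dec c z) as [->|Hcz]; [unfold a, b; lra|].
      pose proof (Hmono c z (proj1 Hc) ltac:(lra) (proj2 Hz)) as H.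
      fold a b in H; lra. }
    assert (Hstart : b * q 0%nat <= a * p 0%nat).
    { pose proof (Hmono 0 z (Rle_refl 0) (proj1 Hz) (proj2 Hz)) as H0.
      fold a b in H0; rewrite !PSeries_0 in H0.
      unfold PS_derive in H0; simpl in H0.
      pose proof (Hpq 0%nat); pose proof (Hqpos 0%nat); pose proof (Hqpos 1%nat).
      apply Rmult_le_reg_r with (q 1%nat); [assumption|]; nra. }
    nra.
Qed.

(** * Landen's transformation *)

(** Equations produced by rules for derivatives live in the carrier of a normed
    module, where [field] and [lra] do not recognise the real numbers. *)
Ltac eq_in_R :=
  match goal with |- @eq _ ?l ?r => change (@eq R l r) end.

Definition landen_arg (x : R) : R := 4 * x / (1 + x) ^ 2.

Definition landen_arg_derive (x : R) : R := 4 * (1 - x) / (1 + x) ^ 3.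

Lemma landen_arg_bounds (x : R) : 0 <= x < 1 -> 0 <= landen_arg x < 1.
Proof.
  intros Hx; unfold landen_arg; split.
  - apply Rdiv_le_0_compat; nra.
  - assert (0 < (1 - x) * (1 - x)) by nra.
    apply (Rdiv_lt_1 (4 * x)); nra.
Qed.

Lemma is_derive_landen_arg (x : R) :
  0 <= x < 1 -> is_derive landen_arg x (landen_arg_derive x).
Proof.
  intros Hx; unfold landen_arg, landen_arg_derive.
  auto_derive; [nra|]; field; nra.
Qed.

Lemma is_derive_landen_sides (G dG : R -> R) (x : R) :
  (forall z, 0 <= z < 1 -> is_derive G z (dG z)) ->
  0 <= x < 1 ->
  is_derive (fun x => (1 + x) * G (x ^ 2)) x
    (G (x ^ 2) + 2 * x * (1 + x) * dG (x ^ 2)) /\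
  is_derive (fun x => G (landen_arg x)) x
    (dG (landen_arg x) * landen_arg_derive x).
Proof.
  intros HG Hx; split.
  - assert (HGx : is_derive (fun x => G (x ^ 2)) x (2 * x * dG (x ^ 2))).
    { apply (is_derive_comp G (fun x => x ^ 2)); [apply HG; nra|].
      auto_derive; [exact I | ring]. }
    replace (G (x ^ 2) + _)
      with (1 * G (x ^ 2) + (1 + x) * (2 * x * dG (x ^ 2))) by ring.
    apply (is_derive_mult (fun x => 1 + x) (fun x => G (x ^ 2)));
      [|exact HGx|exact Rmult_comm].
    auto_derive; [exact I | ring].
  - rewrite Rmult_comm.
    apply (is_derive_comp G landen_arg).
    + now apply HG, landen_arg_bounds.
    + now apply is_derive_landen_arg.
Qed.

(** Stated on derivatives, the form in which it is compared with other power
    series.  With P = x (1 - x) / (1 + x) and Q = (1 - x) / (1 + x)^3, both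
    sides u = (1 + x) G(x^2) and v = G(landen_arg x) of Landen's identity
    satisfy (P u')' = Q u.  So P (u v' - u' v) is constant, and it is 0 at
    x = 0, where P vanishes.  Hence u/v is constant, and it is 1 at 0.  The
    value prescribed for dG 0 is the equation at the singular point 0, where
    dividing by P gives nothing. *)
Lemma landen_of_ode (G dG : R -> R) :
  (forall z, 0 <= z < 1 -> is_derive G z (dG z)) ->
  (forall z, 0 <= z < 1 ->
     is_derive (fun t => t * (1 - t) * dG t) z (G z / 4)) ->
  dG 0 = G 0 / 4 ->
  (forall z, 0 <= z < 1 -> 0 < G z) ->
  forall x, 0 < x < 1 ->
  G (x ^ 2) + 2 * x * (1 + x) * dG (x ^ 2)
  = dG (landen_arg x) * landen_arg_derive x.
Proof.
  intros HG HH HdG0 Hpos.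
  set (H := fun t => t * (1 - t) * dG t) in *.
  assert (Hsq : forall x, 0 <= x < 1 -> 0 <= x ^ 2 < 1) by (intros; nra).
  set (u := fun x => (1 + x) * G (x ^ 2)).
  set (du := fun x => G (x ^ 2) + 2 * x * (1 + x) * dG (x ^ 2)).
  set (v := fun x => G (landen_arg x)).
  set (dv := fun x => dG (landen_arg x) * landen_arg_derive x).
  assert (Hu : forall x, 0 <= x < 1 -> is_derive u x (du x))
    by (intros; now apply is_derive_landen_sides).
  assert (Hv : forall x, 0 <= x < 1 -> is_derive v x (dv x))
    by (intros; now apply is_derive_landen_sides).
  set (P := fun x => x * (1 - x) / (1 + x)).
  set (Q := fun x => (1 - x) / (1 + x) ^ 3).
  assert (HPu : forall x, 0 <= x < 1 ->
            is_derive (fun x => P x * du x) x (Q x * u x)).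
  { intros x Hx.
    apply is_derive_ext_loc with
      (fun x => (x * (1 - x) * G (x ^ 2) + 2 * H (x ^ 2)) / (1 + x)).
    (* The neighbourhood keeps 1 + t away from 0. *)
    { exists (mkposreal (1/2) ltac:(lra)); intros t Ht.
      apply Rabs_lt_between' in Ht; simpl in Ht.
      eq_in_R; unfold H, P, du; field; lra. }
    pose proof (HG (x ^ 2) (Hsq x Hx)) as HGx.
    pose proof (HH (x ^ 2) (Hsq x Hx)) as HHx.
    apply is_derive_unique in HGx as EG; apply is_derive_unique in HHx as EH.
    auto_derive.
    { repeat split; [eexists; exact HGx|eexists; exact HHx|lra]. }
    change (x * (x * 1)) with (x ^ 2).
    change (fun x => G x) with G; change (fun x => H x) with H.
    change (Derive H (x ^ 2) = G (x ^ 2) / 4) in EH.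
    rewrite EG, EH; unfold Q, u, H.
    simpl; field; lra. }
  assert (HPv : forall x, 0 <= x < 1 ->
            is_derive (fun x => P x * dv x) x (Q x * v x)).
  { intros x Hx.
    apply is_derive_ext_loc with (fun x => H (landen_arg x)).
    (* Since y (1 - y) / y' = P for y = landen_arg, the flux P v' is H o y; the
       neighbourhood keeps t away from the zeros 1 of y' and -1 of 1 + t. *)
    { assert (Hp : 0 < Rmin (1 - x) (1 / 2)) by (apply Rmin_pos; lra).
      exists (mkposreal _ Hp); intros t Ht.
      apply Rabs_lt_between' in Ht; simpl in Ht.
      pose proof (Rmin_l (1 - x) (1 / 2)); pose proof (Rmin_r (1 - x) (1 / 2)).
      eq_in_R; unfold H, P, dv, landen_arg, landen_arg_derive; field; lra. }
    replace (Q x * v x)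
      with (scal (landen_arg_derive x) (G (landen_arg x) / 4)).
    { apply (is_derive_comp H landen_arg).
      - now apply HH, landen_arg_bounds.
      - now apply is_derive_landen_arg. }
    unfold scal; simpl; unfold mult; simpl.
    unfold Q, v, landen_arg_derive; field; lra. }
  assert (HW : forall x, 0 <= x < 1 -> P x * (u x * dv x - du x * v x) = 0).
  { intros x Hx.
    set (W := fun x => u x * (P x * dv x) - v x * (P x * du x)).
    assert (HWd : forall t, 0 <= t <= x -> is_derive W t 0).
    { intros t Ht; assert (Ht1 : 0 <= t < 1) by lra.
      replace 0 with ((du t * (P t * dv t) + u t * (Q t * v t))
                      - (dv t * (P t * du t) + v t * (Q t * u t))) by ring.
      apply (is_derive_minus (fun x => u x * (P x * dv x)));
      [apply (is_derive_mult u (fun x => P x * dv x))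
      |apply (is_derive_mult v (fun x => P x * du x))];
      auto; intros; apply Rmult_comm. }
    destruct (Req_dec x 0) as [->|Hx0]; [unfold P; field|].
    pose proof (eq_is_derive W 0 x HWd ltac:(lra)) as E.
    assert (W 0 = 0) by (unfold W, P; field).
    rewrite E in H0; unfold W in H0; lra. }
  assert (Hvpos : forall x, 0 <= x < 1 -> 0 < v x)
    by (intros; now apply Hpos, landen_arg_bounds).
  assert (HW' : forall x, 0 <= x < 1 -> u x * dv x - du x * v x = 0).
  { intros x Hx; destruct (Req_dec x 0) as [->|Hx0].
    - unfold u, dv, du, v, landen_arg, landen_arg_derive.
      replace (4 * 0 / (1 + 0) ^ 2) with 0 by field.
      replace (0 ^ 2) with 0 by ring.
      rewrite HdG0; field.
    - specialize (HW x Hx); apply Rmult_integral in HW as [HW|HW]; [|exact HW].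
      assert (0 < P x) by (unfold P; apply Rdiv_lt_0_compat; nra); lra. }
  intros x Hx.
  assert (Huv : u x = v x).
  { assert (Hd : forall t, 0 <= t <= x -> is_derive (fun x => u x / v x) t 0).
    { intros t Ht; assert (Ht1 : 0 <= t < 1) by lra.
      pose proof (Hvpos t Ht1).
      replace 0 with ((du t * v t - u t * dv t) / v t ^ 2).
      - apply is_derive_div; auto; lra.
      - replace (du t * v t - u t * dv t) with 0
          by (specialize (HW' t Ht1); lra); field; lra. }
    pose proof (eq_is_derive _ 0 x Hd ltac:(lra)) as E; simpl in E.
    pose proof (Hvpos x ltac:(lra)); pose proof (Hvpos 0 ltac:(lra)).
    assert (E0 : u 0 / v 0 = 1).
    { unfold u, v, landen_arg in *.
      replace (4 * 0 / (1 + 0) ^ 2) with 0 in * by field.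
      replace (0 ^ 2) with 0 by ring; field; lra. }
    rewrite E0 in E; symmetry in E.
    apply Rmult_eq_reg_r with (/ v x); [|apply Rinv_neq_0_compat; lra].
    unfold Rdiv in E; rewrite E; field; lra. }
  specialize (HW' x ltac:(lra)); pose proof (Hvpos x ltac:(lra)).
  rewrite Huv in HW'.
  change (du x = dv x); nra.
Qed.

(** * Hypergeometric coefficients *)

Definition hcoef (a b c : R) (n : nat) : R :=
  poch a n * poch b n / poch c n / INR (fact n).

Lemma poch_pos (a : R) (n : nat) : 0 < a -> 0 < poch a n.
Proof.
  intros Ha; induction n as [|n IH]; simpl; [lra|].
  pose proof (pos_INR n); apply Rmult_lt_0_compat; lra.
Qed.

Lemma hcoef_pos (a b c : R) (n : nat) :
  0 < a -> 0 < b -> 0 < c -> 0 < hcoef a b c n.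
Proof.
  intros Ha Hb Hc; unfold hcoef.
  repeat apply Rdiv_lt_0_compat; try (now apply poch_pos).
  - now apply Rmult_lt_0_compat; apply poch_pos.
  - apply INR_fact_lt_0.
Qed.

Lemma hcoef_succ (a b c : R) (n : nat) :
  0 < c ->
  hcoef a b c (S n)
  = hcoef a b c n * ((a + INR n) / (c + INR n) * ((b + INR n) / (1 + INR n))).
Proof.
  intros Hc; unfold hcoef.
  rewrite fact_simpl, mult_INR, S_INR; simpl poch.
  pose proof (poch_pos c n Hc); pose proof (INR_fact_lt_0 n).
  pose proof (pos_INR n).
  field; repeat split; lra.
Qed.

Lemma is_lim_seq_shifted_quotient (a c : R) :
  0 < c -> is_lim_seq (fun n => (a + INR n) / (c + INR n)) 1.
Proof.
  intros Hc.
  apply is_lim_seq_ext with (fun n => 1 + (a - c) * / (c + INR n)).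
  { intros n; pose proof (pos_INR n); field; lra. }
  replace (Finite 1) with (Finite (1 + (a - c) * 0)) by (f_equal; ring).
  apply is_lim_seq_plus'; [apply is_lim_seq_const|].
  apply is_lim_seq_mult'; [apply is_lim_seq_const|].
  change (Finite 0) with (Rbar_inv p_infty).
  apply is_lim_seq_inv; [|discriminate].
  apply is_lim_seq_le_p_loc with INR; [|apply is_lim_seq_INR].
  exists 0%nat; intros; lra.
Qed.

Lemma CV_radius_hcoef (a b c : R) :
  0 < a -> 0 < b -> 0 < c -> CV_radius (hcoef a b c) = 1.
Proof.
  intros Ha Hb Hc.
  replace (Finite 1) with (Finite (/ 1)) by (f_equal; field).
  apply CV_radius_finite_DAlembert; [|lra|].
  - intros n; pose proof (hcoef_pos a b c n Ha Hb Hc); lra.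
  - apply is_lim_seq_ext with
      (fun n => (a + INR n) / (c + INR n) * ((b + INR n) / (1 + INR n))).
    + intros n; pose proof (hcoef_pos a b c n Ha Hb Hc).
      pose proof (pos_INR n).
      rewrite hcoef_succ by assumption.
      set (r := (a + INR n) / _ * _).
      replace (hcoef a b c n * r / hcoef a b c n) with r by (field; lra).
      symmetry; apply Rabs_right, Rle_ge; unfold r.
      apply Rmult_le_pos; apply Rdiv_le_0_compat; lra.
    + replace (Finite 1) with (Finite (1 * 1)) by (f_equal; ring).
      apply is_lim_seq_mult'; apply is_lim_seq_shifted_quotient; lra.
Qed.

Lemma hcoef_derive_pos (a b c z : R) :
  0 < a -> 0 < b -> 0 < c -> 0 <= z < 1 ->
  0 < PSeries (PS_derive (hcoef a b c)) z.
Proof.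
  intros Ha Hb Hc Hz; apply PSeries_pos; [| |exact Hz].
  - now rewrite CV_radius_derive; apply CV_radius_hcoef.
  - apply PS_derive_pos; intros n; now apply hcoef_pos.
Qed.

(** The hypergeometric equation for parameters (1/2, 1/2; 1) in self-adjoint
    form, (z (1 - z) G')' = G / 4.  With T = z G', it reads
    T' - z T' - T = G / 4; the n-th coefficients are
    (n + 1)^2 g_(n+1) - n^2 g_n - n g_n = g_n / 4,
    which is the recurrence (n + 1)^2 g_(n+1) = (n + 1/2)^2 g_n. *)
Lemma elliptic_ode (z : R) :
  let g := hcoef (1 / 2) (1 / 2) 1 in
  0 <= z < 1 ->
  is_derive (fun t => t * (1 - t) * PSeries (PS_derive g) t) z
    (PSeries g z / 4).
Proof.
  intros g Hz.
  set (T := PS_incr_1 (PS_derive g)).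
  assert (Hg : CV_radius g = 1) by (apply CV_radius_hcoef; lra).
  assert (HT : CV_radius T = 1)
    by (unfold T; now rewrite CV_radius_incr_1, CV_radius_derive).
  assert (HdT : CV_radius (PS_derive T) = 1) by now rewrite CV_radius_derive.
  assert (Hex : forall p, CV_radius p = 1 -> ex_pseries p z)
    by (intros; now apply CV_radius_inside, unit_disk).
  apply is_derive_ext with (fun t => (1 - t) * PSeries T t).
  { intros t; unfold T; rewrite PSeries_incr_1; eq_in_R; ring. }
  assert (HTz := is_derive_PSeries T z (unit_disk T z HT Hz)).
  replace (PSeries g z / 4)
    with ((-1) * PSeries T z + (1 - z) * PSeries (PS_derive T) z).
  { apply (is_derive_mult (fun t => 1 - t) (PSeries T));
      [|exact HTz|exact Rmult_comm].
    auto_derive; [exact I | ring]. }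
  assert (Hcoef : PSeries (PS_minus (PS_minus (PS_derive T) T)
                             (PS_incr_1 (PS_derive T))) z
                  = PSeries (PS_scal (1 / 4) g) z).
  { apply PSeries_ext; intros n.
    unfold PS_minus, PS_scal, PS_derive, T, PS_incr_1, PS_derive.
    unfold plus, opp, scal; simpl.
    unfold mult; simpl.
    destruct n as [|n].
    - eq_in_R.
      unfold g; rewrite hcoef_succ by lra; unfold zero; simpl; field.
    - eq_in_R.
      unfold g; rewrite !(hcoef_succ _ _ _ (S n)) by lra.
      pose proof (pos_INR n).
      change (match n with 0%nat => 1 | S _ => INR n + 1 end) with (INR (S n)).
      rewrite S_INR; field; lra. }
  assert (HiT : CV_radius (PS_incr_1 (PS_derive T)) = 1)
    by now rewrite CV_radius_incr_1.
  rewrite PSeries_scal, !PSeries_minus, PSeries_incr_1 in Hcoef;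
    auto using ex_pseries_minus.
  lra.
Qed.

(** * The Landen gap and its derivative *)

Definition landen_gap_derive (p : nat -> R) (x : R) : R :=
  PSeries p (x ^ 2) + 2 * x * (1 + x) * PSeries (PS_derive p) (x ^ 2)
  - PSeries (PS_derive p) (landen_arg x) * landen_arg_derive x.

Lemma is_derive_landen_gap (p : nat -> R) (x : R) :
  CV_radius p = 1 -> 0 <= x < 1 ->
  is_derive (fun x => (1 + x) * PSeries p (x ^ 2) - PSeries p (landen_arg x)) x
    (landen_gap_derive p x).
Proof.
  intros Hp Hx.
  destruct (is_derive_landen_sides (PSeries p) (PSeries (PS_derive p)) x)
    as [Hl Hr]; [|exact Hx|].
  - intros z Hz; now apply is_derive_PSeries, unit_disk.
  - exact (is_derive_minus _ _ _ _ _ Hl Hr).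
Qed.

Lemma landen_gap_derive_half (x : R) :
  0 < x < 1 -> landen_gap_derive (hcoef (1 / 2) (1 / 2) 1) x = 0.
Proof.
  intros Hx; unfold landen_gap_derive.
  set (g := hcoef (1 / 2) (1 / 2) 1).
  assert (Hg : CV_radius g = 1) by (apply CV_radius_hcoef; lra).
  rewrite (landen_of_ode (PSeries g) (PSeries (PS_derive g))); [ring|..].
  - intros z Hz; now apply is_derive_PSeries, unit_disk.
  - exact elliptic_ode.
  - rewrite !PSeries_0; unfold PS_derive, g.
    rewrite hcoef_succ by lra; simpl; field.
  - intros z Hz; apply PSeries_pos; auto.
    intros n; apply hcoef_pos; lra.
  - exact Hx.
Qed.

(** Let z = x^2.  The terms 2 x (1 + x) P'(z) Q'(z) of the two sides cancel;
    what remains is the Wronskian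
    inequality at z and the comparison of P'/Q' at z and at landen_arg x,
    which is larger than z. *)
Lemma landen_gap_derive_cmp (p q : nat -> R) (x : R) :
  CV_radius p = 1 -> CV_radius q = 1 ->
  (forall n, 0 < q n) ->
  (forall n, p (S n) * q n <= p n * q (S n)) ->
  p 2%nat * q 1%nat < p 1%nat * q 2%nat ->
  0 < x < 1 ->
  landen_gap_derive q x * PSeries (PS_derive p) (x ^ 2)
  < landen_gap_derive p x * PSeries (PS_derive q) (x ^ 2).
Proof.
  intros Hp Hq Hqpos Hpq Hpq1 Hx; unfold landen_gap_derive.
  assert (Hz : 0 < x ^ 2 < 1) by nra.
  assert (Hzy : x ^ 2 < landen_arg x).
  { unfold landen_arg.
    apply Rmult_lt_reg_r with ((1 + x) ^ 2); [nra|].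
    replace (4 * x / (1 + x) ^ 2 * (1 + x) ^ 2) with (4 * x) by (field; lra).
    assert (x * (1 + x) ^ 2 < 4) by nra; nra. }
  assert (Hy := landen_arg_bounds x ltac:(lra)).
  assert (Hdy : 0 < landen_arg_derive x).
  { unfold landen_arg_derive.
    apply Rdiv_lt_0_compat; [lra | apply pow_lt; lra]. }
  pose proof (PSeries_wronskian_nonneg p q (x ^ 2) Hp Hq Hqpos Hpq Hpq1 Hz).
  pose proof (PSeries_derive_ratio_decr p q (x ^ 2) (landen_arg x) Hp Hq Hqpos
    Hpq Hpq1 ltac:(lra) Hzy (proj2 Hy)).
  nra.
Qed.

Lemma s_eq_landen_gap (a b r : R) :
  0 <= r ->
  s a b r = (1 + sqrt r) * PSeries (hcoef a b (a + b)) (sqrt r ^ 2)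
            - PSeries (hcoef a b (a + b)) (landen_arg (sqrt r)).
Proof. intros Hr; rewrite pow2_sqrt by exact Hr; reflexivity. Qed.

(** Taking sign to be 1 or -1 gives the two directions of monotonicity. *)
Lemma s_monotone_of_derive (a b sign : R) :
  0 < a -> 0 < b ->
  (forall x, 0 < x < 1 ->
     0 < sign * landen_gap_derive (hcoef a b (a + b)) x) ->
  forall r1 r2, 0 < r1 -> r1 < r2 -> r2 < 1 ->
  sign * s a b r1 < sign * s a b r2.
Proof.
  intros Ha Hb Hpos r1 r2 H1 H12 H2.
  set (p := hcoef a b (a + b)) in *.
  assert (Hp : CV_radius p = 1) by (apply CV_radius_hcoef; lra).
  rewrite !s_eq_landen_gap by lra; fold p.
  apply (incr_function
    (fun x => sign * ((1 + x) * PSeries p (x ^ 2) - PSeries p (landen_arg x)))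
    0 1 (fun x => sign * landen_gap_derive p x)); simpl.
  - intros x Hx0 Hx1.
    apply is_derive_scal, is_derive_landen_gap; [exact Hp | lra].
  - intros x Hx0 Hx1; apply Hpos; lra.
  - now apply sqrt_lt_R0.
  - apply sqrt_lt_1; lra.
  - rewrite <- sqrt_1; apply sqrt_lt_1; lra.
Qed.

(** * The parameter regions *)

(** The increments of the coefficient quotient p_n / g_n have the sign opposite
    to (a + b)/4 - a b + n (1/4 - a b), which is affine in n.  So a constant
    sign for all n is a condition on its constant term and its slope. *)
Lemma half_coef_cross (a b : R) (n : nat) :
  0 < a -> 0 < b ->
  let p := hcoef a b (a + b) in
  let g := hcoef (1 / 2) (1 / 2) 1 in
  exists k, 0 < k /\
    p n * g (S n) - p (S n) * g n
    = k * ((a + b) / 4 - a * b + INR n * (1 / 4 - a * b)).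
Proof.
  intros Ha Hb p g; unfold p, g.
  pose proof (pos_INR n).
  exists (hcoef a b (a + b) n * hcoef (1 / 2) (1 / 2) 1 n
          / ((a + b + INR n) * (1 + INR n) ^ 2)); split.
  - apply Rdiv_lt_0_compat.
    + apply Rmult_lt_0_compat; apply hcoef_pos; lra.
    + apply Rmult_lt_0_compat; [|apply pow_lt]; lra.
  - rewrite !hcoef_succ by lra; field; lra.
Qed.

Lemma half_of_sum_prod (a b : R) :
  a + b <= 1 -> 1 / 4 <= a * b -> 0 < a -> 0 < b -> a = 1 / 2 /\ b = 1 / 2.
Proof.
  intros Hs Hm Ha Hb.
  assert (Hd : a - b = 0).
  { apply Rsqr_0_uniq, Rle_antisym; [|apply Rle_0_sqr]; unfold Rsqr; nra. }
  split; nra.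
Qed.

Lemma coef_conditions_D3 (a b : R) :
  (a, b) <> (1 / 2, 1 / 2) -> D3 a b -> a * b <= (a + b) / 4 /\ a * b < 1 / 4.
Proof.
  intros Hab (Ha & Hb & Hs); split.
  - assert (0 <= (a - b) ^ 2) by apply pow2_ge_0; nra.
  - apply Rnot_le_lt; intros H; apply Hab.
    destruct (half_of_sum_prod a b) as [-> ->]; auto.
Qed.

(** The defining inequality of D2 is a + b <= 4 a b.  With
    4 a b <= (a + b)^2 it gives a + b >= 1, hence a b >= 1/4. *)
Lemma coef_conditions_D2 (a b : R) :
  (a, b) <> (1 / 2, 1 / 2) -> D2 a b -> (a + b) / 4 <= a * b /\ 1 / 4 < a * b.
Proof.
  intros Hab (Ha & Hb & Hs).
  assert (H : a + b <= 4 * (a * b)).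
  { replace (a + b) with ((1 / a + 1 / b) * (a * b)) by (field; lra).
    apply Rmult_le_compat_r; nra. }
  split; [lra|].
  assert (Hsq : 0 <= (a - b) ^ 2) by apply pow2_ge_0.
  apply Rnot_le_lt; intros H'; apply Hab.
  assert (1 / 4 <= a * b) by nra.
  destruct (half_of_sum_prod a b) as [-> ->]; auto; lra.
Qed.

(** * Monotonicity of the gap *)

Lemma landen_gap_derive_pos (a b x : R) :
  (a, b) <> (1 / 2, 1 / 2) -> D3 a b -> 0 < x < 1 ->
  0 < landen_gap_derive (hcoef a b (a + b)) x.
Proof.
  intros Hab HD Hx.
  destruct (coef_conditions_D3 a b Hab HD) as [Hc0 Hc1].
  destruct HD as (Ha & Hb & _).
  assert (Hcmp := landen_gap_derive_cmp (hcoef a b (a + b))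
                    (hcoef (1 / 2) (1 / 2) 1) x).
  rewrite landen_gap_derive_half, Rmult_0_l in Hcmp by exact Hx.
  apply Rmult_lt_reg_r with
    (PSeries (PS_derive (hcoef (1 / 2) (1 / 2) 1)) (x ^ 2)).
  { apply hcoef_derive_pos; nra. }
  rewrite Rmult_0_l; apply Hcmp; try (apply CV_radius_hcoef; lra).
  - intros n; apply hcoef_pos; lra.
  - intros n; destruct (half_coef_cross a b n Ha Hb) as (k & Hk & E).
    assert (0 <= k * ((a + b) / 4 - a * b + INR n * (1 / 4 - a * b))); [|lra].
    pose proof (Rmult_le_pos (INR n) (1 / 4 - a * b) (pos_INR n) ltac:(lra)).
    apply Rmult_le_pos; lra.
  - destruct (half_coef_cross a b 1 Ha Hb) as (k & Hk & E).
    assert (0 < k * ((a + b) / 4 - a * b + INR 1 * (1 / 4 - a * b))); [|lra].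
    apply Rmult_lt_0_compat; simpl; lra.
  - exact Hx.
Qed.

(** On D2 the roles of the two series in the comparison are exchanged. *)
Lemma landen_gap_derive_neg (a b x : R) :
  (a, b) <> (1 / 2, 1 / 2) -> D2 a b -> 0 < x < 1 ->
  landen_gap_derive (hcoef a b (a + b)) x < 0.
Proof.
  intros Hab HD Hx.
  destruct (coef_conditions_D2 a b Hab HD) as [Hc0 Hc1].
  destruct HD as (Ha & Hb & _).
  assert (Hcmp := landen_gap_derive_cmp (hcoef (1 / 2) (1 / 2) 1)
                    (hcoef a b (a + b)) x).
  rewrite landen_gap_derive_half, Rmult_0_l in Hcmp by exact Hx.
  apply Rmult_lt_reg_r with
    (PSeries (PS_derive (hcoef (1 / 2) (1 / 2) 1)) (x ^ 2)).
  { apply hcoef_derive_pos; nra. }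
  rewrite Rmult_0_l; apply Hcmp; try (apply CV_radius_hcoef; lra).
  - intros n; apply hcoef_pos; lra.
  - intros n; destruct (half_coef_cross a b n Ha Hb) as (k & Hk & E).
    assert (0 <= k * (a * b - (a + b) / 4 + INR n * (a * b - 1 / 4))); [|lra].
    pose proof (Rmult_le_pos (INR n) (a * b - 1 / 4) (pos_INR n) ltac:(lra)).
    apply Rmult_le_pos; lra.
  - destruct (half_coef_cross a b 1 Ha Hb) as (k & Hk & E).
    assert (0 < k * (a * b - (a + b) / 4 + INR 1 * (a * b - 1 / 4))); [|lra].
    apply Rmult_lt_0_compat; simpl; lra.
  - exact Hx.
Qed.

Theorem lemma3p6 (a b : R) (ha : 0 < a) (hb : 0 < b)
  (hab : (a, b) <> (1 / 2, 1 / 2)) :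
  (D3 a b -> increasing_on_01 (s a b)) /\
  (D2 a b -> decreasing_on_01 (s a b)).
Proof.
  split; intros HD r1 r2 H1 H12 H2.
  - cut (1 * s a b r1 < 1 * s a b r2); [lra|].
    apply s_monotone_of_derive; auto.
    intros x Hx; pose proof (landen_gap_derive_pos a b x hab HD Hx); lra.
  - cut (-1 * s a b r1 < -1 * s a b r2); [lra|].
    apply s_monotone_of_derive; auto.
    intros x Hx; pose proof (landen_gap_derive_neg a b x hab HD Hx); lra.
Qed.
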